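(* Let $\mathcal M\subseteq\mathcal X$ be a nonempty set of states whose stability levels are strictly greater than those of states not in $\mathcal M$, that is, \[ \mathcal V_\sigma<\mathcal V_\eta\quad\text{for all }\eta\in\mathcal M,\ \sigma\notin\mathcal M . \] Let $\mathcal V=\min_{\eta\in\mathcal M}\mathcal V_\eta$, assumed finite, let $\theta_\beta=e^{\beta\mathcal V}$, and let $\Delta=\mathcal X\setminus\mathcal M$. Then for every $\xi\in\mathcal X$ and $t>0$, \[ \lim_{\beta\to\infty}\frac1{\theta_\beta}\,\mathbb E_\xi^\beta\left[\int_0^{t\theta_\beta}\mathbf 1_{\{X_\beta(s)\in\Delta\}}\,ds\right]=0 . \]
   Context: Let $K,L$ be positive integers and let $(V,E)$ be the $K\times L$ rectangular lattice graph with periodic boundary conditions: $V=(\mathbb Z/K\mathbb Z)\times(\mathbb Z/L\mathbb Z)$ and $E$ is the set of nearest-neighbour edges. Let $0<h_1<h_2<h_3<1$ be real numbers. Standing assumptions: (A) $K$ and $L$ are both greater than $\frac{3}{h_3-h_2}$ and greater than $\frac{3}{h_2-h_1}$; (B) $a(h_2-h_1)+b(h_3-h_2)\notin\mathbb Z$ for all $(a,b)\in\mathbb Z^2\setminus\{(0,0)\}$. All these parameters are fixed as $\beta\to\infty$. The configuration space is $\mathcal X=\{1,2,3\}^V$, with Hamiltonian \[ H(\sigma)=-\sum_{\{x,y\}\in E}\mathbf 1_{\{\sigma(x)=\sigma(y)\}}-\sum_{x\in V}h_{\sigma(x)} . \] Two configurations are adjacent if they differ at exactly one site. For $\beta>0$,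 $\{X_\beta(t)\}_{t\ge0}$ is the continuous-time Markov chain on $\mathcal X$ with jump rates $c_\beta(\sigma,\eta)=e^{-\beta[H(\eta)-H(\sigma)]_+}$ if $\sigma,\eta$ are adjacent, and $0$ otherwise, where $[t]_+=\max(t,0)$. $\mathbb E_\sigma^\beta$ denotes the expectation for the chain started at $\sigma$. A path from $\sigma$ to $\eta$ is a finite sequence of successively adjacent configurations starting at $\sigma$ and ending at $\eta$. The communication height $\Phi(\sigma,\eta)$ is the minimum over all paths from $\sigma$ to $\eta$ of the maximum of $H$ along the path; for $A\subseteq\mathcal X$, $\Phi(\sigma,A)=\min_{\eta\in A}\Phi(\sigma,\eta)$ and $\Gamma(\sigma,A)=\Phi(\sigma,A)-H(\sigma)$. The stability level of $\sigma$ is $\mathcal V_\sigma=\Gamma(\sigma,I_\sigma)$ with $I_\sigma=\{\eta\in\mathcal X:H(\eta)<H(\sigma)\}$, and $\mathcal V_\sigma=\infty$ if $I_\sigma=\emptyset$. *)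

(* Defs.v *)
From HB Require Import structures.
From mathcomp Require Export all_boot all_order all_algebra.
From mathcomp Require Export all_classical all_reals all_analysis.

Set Implicit Arguments.
Unset Strict Implicit.
Unset Printing Implicit Defensive.

Import Order.TTheory GRing.Theory Num.Theory.
Export numFieldNormedType.Exports.

#[global] Open Scope ring_scope.

Section Potts.
Variables (R : realType) (K L : nat).

(* Z/K x Z/L; [ordS] is the cyclic successor. *)
Definition vertex : finType := ('I_K * 'I_L)%type.

(* Edges are unordered pairs.  The torus is used only with K, L >= 3, where
   there are no loops and no multiple edges. *)
Definition edges : {set {set vertex}} :=
  [set [set x; (ordS x.1, x.2)] | x : vertex]%SET
  :|: [set [set x; (x.1, ordS x.2)] | x : vertex]%SET.

(* The spins 1, 2, 3 are encoded as 0, 1, 2 in 'I_3. *)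
Definition config : finType := {ffun vertex -> 'I_3}.

Definition agree (s : config) (e : {set vertex}) : bool :=
  [forall x in e, [forall y in e, s x == s y]].

Definition hamiltonian (h : 'I_3 -> R) (s : config) : R :=
  - (\sum_(e in edges) (agree s e)%:R) - \sum_(x : vertex) h (s x).

Definition adjacent (s u : config) : bool := #|[set x | s x != u x]%SET| == 1%N.

Variable h : 'I_3 -> R.
Let H := hamiltonian h.

Definition rate (beta : R) (s u : config) : R :=
  if adjacent s u then expR (- beta * Num.max (H u - H s) 0) else 0.

Definition height (s : config) (p : seq config) : R :=
  \big[Num.max/H s]_(u <- p) H u.

(* The infimum is attained: H takes finitely many values and the configuration
   space is connected. *)
Definition Phi (s u : config) : R :=
  inf [set m | exists p, [/\ path adjacent s p, last s p = u & m = height s p]]%classic.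

(* The minimum over the empty set is +oo. *)
Definition PhiSet (s : config) (A : {set config}) : \bar R :=
  \big[Order.min/+oo%E]_(u in A) (Phi s u)%:E.

Definition Gam (s : config) (A : {set config}) : \bar R :=
  (PhiSet s A - (H s)%:E)%E.

Definition lower_set (s : config) : {set config} := [set u | H u < H s]%SET.

(* Equals +oo when [lower_set s] is empty. *)
Definition stability_level (s : config) : \bar R := Gam s (lower_set s).

Definition min_stability_level (M : {set config}) : \bar R :=
  \big[Order.min/+oo%E]_(u in M) stability_level u.

End Potts.

Section MarkovChain.
Variables (R : realType) (S : finType) (c : S -> S -> R).

Definition generator (f : S -> R) : S -> R :=
  fun x => \sum_(y : S) c x y * (f y - f x).

(* The (x, y) entry of the exponential of t times the generator. *)
Definition transition (t : R) (x y : S) : R :=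
  limn (series (fun k : nat =>
    t ^+ k / k`!%:R * iter k generator (fun z => (z == y)%:R) x)).

(* Right-continuous process on S started at x0 whose finite-dimensional
   distributions are those of the Markov semigroup with jump rates c. *)
Definition markov_chain (x0 : S) (d : measure_display) (T : measurableType d)
    (P : probability T R) (X : R -> T -> S) : Prop :=
  [/\ forall t x, 0 <= t -> measurable [set w | X t w = x]%classic,
      forall w t, 0 <= t -> \forall s \near (t^'+)%classic, X s w = X t w &
      forall (n : nat) (t : nat -> R) (x : nat -> S),
        t 0%N = 0 -> x 0%N = x0 -> (forall i, t i <= t i.+1) ->
        P [set w | forall i, (i <= n)%N -> X (t i) w = x i]%classic =
        (\prod_(i < n) transition (t i.+1 - t i) (x i) (x i.+1))%:E].

End MarkovChain.

(* Main.v *)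
Require Import Defs.
From HB Require Import structures.
From mathcomp Require Import measurable_realfun ring lra.

Set Implicit Arguments.
Unset Strict Implicit.
Unset Printing Implicit Defensive.

Import Order.TTheory GRing.Theory Num.Theory.

(* Put lam = 1 / (t theta_beta) and let L be the generator.  For a state y
   outside M let g = lam (lam - L)^-1 1_y.  Then lam times the expected time spent
   in y up to time 1 / lam is at most e g(xi), and g(xi) <= g(y) by the maximum
   principle, so it suffices that g(y) -> 0.  The stability level of y is below V,
   so a path of height m < H(y) + V leads from y to some z with H(z) < H(y).
   Integrating (lam - L) g = lam 1_y against the reversible measure gives
   g(z) <= exp(-beta (H(y) - H(z))), while the Dirichlet form of g is at most
   lam exp(-beta H(y)), which bounds each increment of g along the path by
   sqrt (2 lam exp(beta (m - H(y)))) = sqrt (2 / t) exp(-beta (V + H(y) - m) / 2). *)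

(** * Resolvents of a finite Markov generator, and their energy estimates under reversibility *)

Section Reversible.
Variables (R : realType) (S : finType) (c : S -> S -> R).
Hypothesis c_ge0 : forall x y, 0 <= c x y.

(** Minimum principle: at a minimiser [m] of [g] the generator term is nonnegative, so
    [lam * g m >= 0]. *)
Lemma resolvent_ge0 (lam : R) (g : S -> R) : 0 < lam ->
  (forall x, 0 <= lam * g x - generator c g x) -> forall x, 0 <= g x.
Proof.
move=> lam0 hg x.
have [m _ hm] := Order.TotalTheory.arg_minP g (erefl : xpredT x).
apply: (le_trans _ (hm x isT)).
rewrite -(pmulr_rge0 _ lam0); apply: le_trans (hg m) _.
rewrite gerBl; apply: sumr_ge0 => y _.
by rewrite mulr_ge0 // subr_ge0 hm.
Qed.

(** For [lam > 0], [g x] is the probability that the chain started at [x] is in [y] at an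
    independent exponential time of rate [lam]. *)
Definition resolvent_kernel (lam : R) (y : S) (g : S -> R) :=
  forall x, lam * g x - generator c g x = lam * (x == y)%:R.

Lemma resolvent_kernel_ge0 lam y g : 0 < lam -> resolvent_kernel lam y g ->
  forall x, 0 <= g x.
Proof.
move=> lam0 hg; apply: (resolvent_ge0 lam0) => x.
by rewrite hg mulr_ge0 ?ler0n // ltW.
Qed.

(** Maximum principle: at a maximiser [m] other than [y] the equation reads
    [lam * g m = generator c g m <= 0], so [g m <= 0 <= g y]. *)
Lemma resolvent_kernel_le lam y g : 0 < lam -> resolvent_kernel lam y g ->
  forall x, g x <= g y.
Proof.
move=> lam0 hg x.
have [m _ hm] := Order.TotalTheory.arg_maxP g (erefl : xpredT x).
have [<-|mNy] := eqVneq m y; first exact: hm.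
apply: le_trans (hm x isT) _.
apply: le_trans (resolvent_kernel_ge0 lam0 hg y).
have := hg m; rewrite (negPf mNy) mulr0 => /eqP; rewrite subr_eq0 => /eqP e.
rewrite -(pmulr_rle0 _ lam0) e; apply: sumr_le0 => z _.
by rewrite mulr_ge0_le0 // subr_le0; exact: hm.
Qed.

Lemma generator_linear a (f g : S -> R) x :
  generator c (fun z => a * f z + g z) x = a * generator c f x + generator c g x.
Proof.
by rewrite /generator mulr_sumr -big_split; apply: eq_bigr => z _ /=; ring.
Qed.

(** The minimum principle, applied to a difference in both orders, makes [lam - generator c]
    injective, hence invertible on the finite-dimensional space of functions on [S]. *)
Lemma resolvent_kernel_exists lam y : 0 < lam -> exists g, resolvent_kernel lam y g.
Proof.
move=> lam0.
pose phi (f : {ffun S -> R^o}) : {ffun S -> R^o} :=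
  [ffun x => lam * f x - generator c f x].
have phi_lin : linear phi.
  move=> a u v; apply/ffunP => x; rewrite !ffunE /GRing.scale /=.
  have -> : generator c (a *: u + v) x = a * generator c u x + generator c v x.
    rewrite -generator_linear; apply: eq_bigr => z _.
    by rewrite !ffunE.
  ring.
pose phiL := GRing.isLinear.Build R {ffun S -> R^o} {ffun S -> R^o} *:%R phi phi_lin.
pose phiM : {linear {ffun S -> R^o} -> {ffun S -> R^o}} := HB.pack phi phiL.
have ker0 : lker (linfun phiM) == 0%VS.
  have le u v : phi u = phi v -> forall x, v x <= u x.
    move=> /ffunP e x; rewrite -subr_ge0 addrC -mulN1r.
    apply: (@resolvent_ge0 lam (fun z => -1 * v z + u z)) => // z.
    have := e z; rewrite !ffunE generator_linear; lra.
  apply/lker0P => u v; rewrite !lfunE /= => e.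
  by apply/ffunP => x; apply/eqP; rewrite eq_le !le.
exists ((linfun phiM)^-1%VF [ffun x => lam * (x == y)%:R]) => x.
have := lker0_lfunVK ker0 [ffun x => lam * (x == y)%:R : R^o].
by rewrite lfunE /= => /ffunP/(_ x); rewrite !ffunE.
Qed.

Variable w : S -> R.
Hypothesis w_gt0 : forall x, 0 < w x.
Hypothesis balance : forall x y, w x * c x y = w y * c y x.

(** Invariance of [w]: detailed balance allows the two summation variables to be exchanged. *)
Lemma sum_generator0 (g : S -> R) : \sum_x w x * generator c g x = 0.
Proof.
pose A := \sum_x \sum_y w x * c x y * g y.
pose B := \sum_x \sum_y w x * c x y * g x.
have -> : \sum_x w x * generator c g x = A - B.
  rewrite -sumrB; apply: eq_bigr => x _; rewrite /generator mulr_sumr -sumrB.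
  by apply: eq_bigr => y _; ring.
suff -> : A = B by rewrite subrr.
rewrite /A exchange_big /=; apply: eq_bigr => x _; apply: eq_bigr => y _.
by rewrite balance.
Qed.

(** Symmetrisation: [A] equals its copy with [x] and [y] exchanged, and adding the two completes the
    square, whence the factor 2. *)
Lemma dirichlet_form (g : S -> R) :
  \sum_x \sum_y w x * c x y * (g x - g y) ^+ 2 =
  - 2 * \sum_x w x * g x * generator c g x.
Proof.
pose A := \sum_x \sum_y w x * c x y * g x * (g x - g y).
have e1 : \sum_x w x * g x * generator c g x = - A.
  rewrite /A -sumrN; apply: eq_bigr => x _.
  by rewrite /generator mulr_sumr -sumrN; apply: eq_bigr => y _; ring.
have e2 : A = \sum_x \sum_y w x * c x y * g y * (g y - g x).
  rewrite /A exchange_big /=; apply: eq_bigr => x _; apply: eq_bigr => y _.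
  by rewrite balance.
rewrite e1 mulrN mulNr opprK mulr_natl mulr2n {2}e2 /A -big_split /=.
apply: eq_bigr => x _; rewrite -big_split /=.
by apply: eq_bigr => y _; ring.
Qed.

Section Kernel.
Variables (lam : R) (y : S) (g : S -> R).
Hypothesis lam0 : 0 < lam.
Hypothesis gE : resolvent_kernel lam y g.
Let g_ge0 := resolvent_kernel_ge0 lam0 gE.

(** Summing the resolvent equation against [w] removes the generator term by invariance. *)
Lemma resolvent_kernel_mass : \sum_x w x * g x = w y.
Proof.
apply: (mulfI (lt0r_neq0 lam0)).
have -> : lam * \sum_x w x * g x = \sum_x w x * (lam * g x - generator c g x).
  transitivity (lam * (\sum_x w x * g x) - \sum_x w x * generator c g x).
    by rewrite sum_generator0 subr0.
  rewrite mulr_sumr -sumrB.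
  by apply: eq_bigr => x _; ring.
under eq_bigr do rewrite gE.
by rewrite (bigD1 y) //= eqxx big1 => [|x /negPf ->] /=; ring.
Qed.

Lemma resolvent_kernel_le_ratio z : g z <= w y / w z.
Proof.
rewrite ler_pdivlMr // -resolvent_kernel_mass (bigD1 z) //= mulrC lerDl.
by apply: sumr_ge0 => x _; rewrite mulr_ge0 // ltW.
Qed.

(** Energy estimate: testing the equation against [w * g] bounds the whole Dirichlet form by
    [2 * lam * w y * g y], and the left side is one of its nonnegative terms. *)
Lemma resolvent_kernel_edge a b :
  w a * c a b * (g a - g b) ^+ 2 <= 2 * lam * w y.
Proof.
apply: (@le_trans _ _ (\sum_x \sum_z w x * c x z * (g x - g z) ^+ 2)).
  have t0 x z : 0 <= w x * c x z * (g x - g z) ^+ 2.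
    by rewrite mulr_ge0 ?sqr_ge0 // mulr_ge0 // ltW.
  rewrite (bigD1 a) //= (bigD1 b) //= -addrA lerDl addr_ge0 // ?sumr_ge0 //.
  by move=> x _; rewrite sumr_ge0.
rewrite dirichlet_form.
have -> : \sum_x w x * g x * generator c g x =
    lam * (\sum_x w x * g x ^+ 2) - lam * (w y * g y).
  have -> : lam * (w y * g y) = \sum_x w x * g x * (lam * (x == y)%:R).
    by rewrite (bigD1 y) //= eqxx big1 => [|x /negPf ->] /=; ring.
  rewrite mulr_sumr -sumrB; apply: eq_bigr => x _; rewrite -gE; ring.
have s0 : 0 <= lam * \sum_x w x * g x ^+ 2.
  by rewrite mulr_ge0 ?sumr_ge0 ?ltW // => x _; rewrite mulr_ge0 ?sqr_ge0 ?ltW.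
(* This is the ratio bound at [z = y]. *)
have gy1 : g y <= 1.
  by have := resolvent_kernel_le_ratio y; rewrite divff // gt_eqF.
have : lam * (w y * g y) <= lam * w y.
  by rewrite ler_pM2l // ler_piMr // ltW.
lra.
Qed.

End Kernel.
End Reversible.

Lemma path_variation (R : realDomainType) (S : Type) (e : rel S) (g : S -> R) (r : R) :
  (forall a b, e a b -> `|g a - g b| <= r) ->
  forall p y, path e y p -> `|g y - g (last y p)| <= (size p)%:R * r.
Proof.
move=> hr; elim=> [|a p IH] y /=; first by rewrite subrr normr0 mul0r.
case/andP => /hr h1 /IH h2.
apply: le_trans (ler_distD (g a) _ _) _.
by rewrite -nat1r mulrDl mul1r lerD.
Qed.

(** * The semigroup as a power series in time, and the occupation integral *)

Section Semigroup.
Variables (R : realType) (S : finType) (c : S -> S -> R).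

(** The exponential of [t] times the generator, applied to [f]; when [f] is the indicator of [y] it
    is [transition c t x y] by conversion. *)
Definition semigroup (f : S -> R) (x : S) (t : R) : R :=
  limn (series (fun k : nat => t ^+ k / k`!%:R * iter k (generator c) f x)).

Lemma iter_generator_linear k a f g x :
  iter k (generator c) (fun z => a * f z + g z) x =
  a * iter k (generator c) f x + iter k (generator c) g x.
Proof.
elim: k x => [|k IH] x //=; rewrite -generator_linear.
by congr (generator c _ x); apply/funext => z.
Qed.

(** A crude geometric bound, enough to dominate the exponential series: the sum of [2 * |c y z|]
    over all pairs bounds the generator in supremum norm. *)
Lemma norm_iter_generator f x k :
  `|iter k (generator c) f x| <=
  (\sum_y \sum_z 2 * `|c y z|) ^+ k * \sum_y `|f y|.
Proof.
elim: k x => [|k IH] x /=.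
  by rewrite expr0 mul1r (bigD1 x) //= ler_wpDr // sumr_ge0.
set C := \sum_y _; set B := \sum_y _.
have B0 : 0 <= C ^+ k * B by apply: le_trans (IH x).
have h : \sum_y 2 * `|c x y| <= C.
  rewrite /C [leRHS](bigD1 x) //= lerDl; apply: sumr_ge0 => y _.
  by apply: sumr_ge0 => z _; rewrite mulr_ge0.
rewrite exprS -mulrA; apply: le_trans (ler_wpM2r B0 h).
apply: le_trans (ler_norm_sum _ _ _) _.
rewrite mulr_suml; apply: ler_sum => y _.
rewrite normrM mulrC [2 * _]mulrC -mulrA mulrC ler_wpM2l //.
apply: le_trans (ler_normB _ _) _.
by rewrite mulr_natl mulr2n lerD ?IH.
Qed.

Let coef f x (k : nat) : R := iter k (generator c) f x / k`!%:R.

Lemma semigroupE f x t : semigroup f x t = limn (pseries (coef f x) t).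
Proof.
rewrite /semigroup /pseries; congr (limn (series _)).
by apply/funext => k; rewrite /coef /=; ring.
Qed.

Lemma is_cvg_coef f x t : cvgn (pseries (coef f x) t).
Proof.
set C := \sum_y \sum_z 2 * `|c y z|; set B := \sum_y `|f y|.
have C0 : 0 <= C.
  by apply: sumr_ge0 => y _; apply: sumr_ge0 => z _; rewrite mulr_ge0.
have B0 : 0 <= B by apply: sumr_ge0.
apply: normed_cvg.
apply: (@series_le_cvg _ _ (B *: exp_coeff (C * `|t|))) => [n|n|n|].
- exact: normr_ge0.
- by rewrite /= /GRing.scale /= mulr_ge0 // exp_coeff_ge0 // mulr_ge0.
- rewrite /= /GRing.scale /= /exp_coeff /= /coef !normrM normfV normrX.
  rewrite (ger0_norm (ler0n _ _)) exprMn.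
  have := norm_iter_generator f x n; rewrite -/C -/B => h.
  rewrite mulrAC [leRHS]mulrA ler_wpM2r ?invr_ge0 ?ler0n //.
  rewrite [leRHS]mulrA [B * _]mulrC.
  by rewrite ler_wpM2r // exprn_ge0.
- by apply: is_cvg_seriesZ; exact: is_cvg_series_exp_coeff.
Qed.

(** The factor [i + 1] cancels against [(i + 1)!], so differentiating termwise amounts to applying
    the generator to [f] once. *)
Lemma pseries_diffs_coef f x : pseries_diffs (coef f x) = coef (generator c f) x.
Proof.
apply/funext => i; rewrite /pseries_diffs /coef -iterSr factS natrM.
have := fact_gt0 i; rewrite lt0n -(pnatr_eq0 R) => i0.
by field; rewrite i0 nat1r pnatr_eq0.
Qed.

Lemma is_derive_semigroup f x (t : R) :
  is_derive t (1 : R) (semigroup f x) (semigroup (generator c f) x t).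
Proof.
have -> : semigroup f x = fun s => limn (pseries (coef f x) s).
  by apply/funext => s; rewrite semigroupE.
rewrite semigroupE -pseries_diffs_coef.
(* The series converges everywhere; [|t| + 1] is just a radius beyond [|t|]. *)
apply: (@pseries_snd_diffs _ _ (`|t| + 1)).
- exact: is_cvg_coef.
- by rewrite pseries_diffs_coef; exact: is_cvg_coef.
- by rewrite !pseries_diffs_coef; exact: is_cvg_coef.
- by rewrite (ger0_norm (addr_ge0 _ _)) // ltrDl.
Qed.

Lemma semigroup_linear a f g x t :
  semigroup (fun z => a * f z + g z) x t = a * semigroup f x t + semigroup g x t.
Proof.
rewrite !semigroupE.
have -> : pseries (coef (fun z => a * f z + g z) x) t =
    (fun n => a * pseries (coef f x) t n + pseries (coef g x) t n).
  apply/funext => n; rewrite /pseries /series /= mulr_sumr -big_split /=.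
  by apply: eq_bigr => i _; rewrite /coef iter_generator_linear; ring.
apply/cvg_lim => //; apply: cvgD; last exact: is_cvg_coef.
by apply: cvgMr; exact: is_cvg_coef.
Qed.

Lemma semigroup_transition f x t : semigroup f x t = \sum_y f y * transition c t x y.
Proof.
have h r : semigroup (fun z => \sum_(y <- r) f y * (z == y)%:R) x t =
    \sum_(y <- r) f y * transition c t x y.
  elim: r => [|y r IH].
    (* The zero function is written as [-1 * f + f] so that linearity gives its image. *)
    rewrite big_nil; transitivity (semigroup (fun z => -1 * f z + f z) x t).
      by congr semigroup; apply/funext => z; rewrite big_nil; ring.
    by rewrite semigroup_linear mulN1r addNr.
  rewrite big_cons -IH -semigroup_linear; congr semigroup.
  by apply/funext => z; rewrite big_cons.
rewrite -h; congr semigroup; apply/funext => z.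
rewrite (bigD1 z) //= eqxx mulr1 big1 ?addr0 // => y yz.
by rewrite eq_sym (negPf yz) mulr0.
Qed.

Lemma semigroup0 f x : semigroup f x 0 = f x.
Proof.
rewrite /semigroup; apply/cvg_lim => //.
(* The partial sum of index 0 is empty; from index 1 on they all equal [f x]. *)
rewrite -(cvg_shiftn 1); apply: cvg_near_cst; apply: nearW => n.
rewrite /series /= addn1 big_nat_recl //= big1 ?addr0 ?expr0 ?fact0 ?divr1 ?mul1r //.
by move=> i _; rewrite expr0n /= !mul0r.
Qed.

Lemma continuous_semigroup f x : continuous (semigroup f x).
Proof.
move=> t; apply/differentiable_continuous/derivable1_diffP.
by have [] := is_derive_semigroup f x t.
Qed.

(** By the resolvent equation, [F] below has derivative [lam * expR (- lam * s) * transition c s x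
    y]. On [[0, lam^-1]] the exponential is at least [expR (-1)], which costs the factor
    [expR 1]. *)
Lemma occupation_le_resolvent (lam : R) (x y : S) (g : S -> R) :
  0 < lam -> resolvent_kernel c lam y g -> (forall z, 0 <= g z) ->
  (forall (s : R) z, 0 <= s -> 0 <= transition c s x z) ->
  (\int[lebesgue_measure]_(s in `[0%R, lam^-1%R]) (transition c s x y)%:E <=
   (expR 1 / lam * g x)%R%:E)%E.
Proof.
move=> lam0 hg g0 p0.
pose F (s : R) := - (expR (- lam * s) * semigroup g x s).
pose f (s : R) := lam * (expR (- lam * s) * transition c s x y).
have dF s : is_derive s (1 : R) F (f s).
  have h1 : is_derive s (1 : R) (fun s => expR (- lam * s))
      (- lam * expR (- lam * s)).
    have h0 : is_derive s (1 : R) (fun s => - lam * s) (- lam).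
      have := is_deriveZ (f := (id : R -> R)) (- lam) (is_derive_id s (1 : R)).
      by rewrite /GRing.scale /= mulr1.
    have := @is_derive1_comp _ expR (fun s => - lam * s) s _ _
      (is_derive_expR _) h0.
    by rewrite mulrC.
  have h2 := is_derive_semigroup g x s.
  have -> : f s = - (expR (- lam * s) * semigroup (generator c g) x s +
     semigroup g x s * (- lam * expR (- lam * s))).
    (* [generator c g - lam * g] is [- lam] times the indicator of [y], so one term of the expansion
       survives. *)
    have : semigroup (fun z => - lam * g z + generator c g z) x s =
        - lam * transition c s x y.
      rewrite semigroup_transition.
      rewrite (bigD1 y) //= big1 ?addr0.
        by have := hg y; rewrite eqxx /= => e; congr (_ * _); lra.
      move=> z /negPf zy; have := hg z; rewrite zy mulr0 => e.
      by rewrite [X in X * _](_ : _ = 0) ?mul0r //; lra.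
    rewrite semigroup_linear /f => e.
    rewrite (mulrCA lam) -[lam * _]opprK -mulNr -e; ring.
  exact: (is_deriveN (is_deriveM h1 h2)).
have cF : continuous F.
  by move=> s; apply/differentiable_continuous/derivable1_diffP; have [] := dF s.
have ct : continuous (fun s => transition c s x y) by exact: continuous_semigroup.
have cf : continuous f.
  move=> s; apply: cvgMr; apply: cvgM; last exact: ct.
  apply: (continuous_comp (f := fun s => - lam * s) (g := expR)).
    by apply: cvgMr; exact: cvg_id.
  exact: continuous_expR.
have L0 : 0 < lam^-1 by rewrite invr_gt0.
have FTC : (\int[lebesgue_measure]_(s in `[0%R, lam^-1%R]) (f s)%:E =
    (F lam^-1%R)%:E - (F 0)%:E)%E.
  apply: continuous_FTC2 => //.
  - exact: continuous_subspaceT.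
  - split.
    + by move=> s _; have [] := dF s.
    + exact/cvg_at_right_filter/cF.
    + exact/cvg_at_left_filter/cF.
  - by move=> s _; rewrite derive1E; have [_ ->] := dF s.
(* [F 0 = - g x], and [F lam^-1 <= 0] because [g] and the transition probabilities are
   nonnegative. *)
have FT : F lam^-1 - F 0 <= g x.
  rewrite /F mulr0 expR0 mul1r semigroup0 opprK gerDr oppr_le0 mulr_ge0 ?expR_ge0 //.
  rewrite semigroup_transition; apply: sumr_ge0 => z _.
  by rewrite mulr_ge0 // p0 // ltW.
apply: (@le_trans _ _ (\int[lebesgue_measure]_(s in `[0%R, lam^-1%R])
    ((expR 1 / lam)%:E * (f s)%:E)))%E.
  apply: ge0_le_integral => //.
  - by move=> s /=; rewrite in_itv /= => /andP[s0 _]; rewrite lee_fin; exact: p0.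
  - apply/measurable_EFinP; apply: measurable_funTS.
    exact: continuous_measurable_fun.
  - apply: measurable_funeM; apply/measurable_EFinP; apply: measurable_funTS.
    exact: continuous_measurable_fun.
  - move=> s /=; rewrite in_itv /= => /andP[s0 s1]; rewrite lee_fin.
    rewrite /f -mulrA mulKf ?gt_eqF // mulrA -expRD ler_peMl ?p0 //.
    by rewrite -[leLHS]expR0 ler_expR mulNr subr_ge0 -(mulfV (lt0r_neq0 lam0)) ler_pM2l.
rewrite ge0_integralZl_EFin //; first last.
- by rewrite divr_ge0 ?expR_ge0 // ltW.
- apply/measurable_EFinP; apply: measurable_funTS; exact: continuous_measurable_fun.
- move=> s /=; rewrite in_itv /= => /andP[s0 _]; rewrite lee_fin.
  by rewrite !mulr_ge0 ?expR_ge0 ?p0 // ltW.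
by rewrite FTC -EFinB -EFinM lee_fin ler_wpM2l // divr_ge0 ?expR_ge0 // ltW.
Qed.

End Semigroup.

(** * Joint measurability of the process and its expected occupation time *)

Section OccupationTime.
Variables (R : realType) (S : finType) (d : measure_display) (T : measurableType d).
Variables (P : probability T R) (X : R -> T -> S).
Hypothesis mX : forall t x, 0 <= t -> measurable [set w | X t w = x]%classic.
Hypothesis rcX : forall w t, 0 <= t -> \forall s \near (t^'+)%classic, X s w = X t w.

Local Open Scope classical_set_scope.

Lemma measurable_state_in (A : {set S}) t : 0 <= t -> measurable [set w | X t w \in A].
Proof.
move=> t0.
have -> : [set w | X t w \in A] = \bigcup_(y in [set` A]) [set w | X t w = y].
  by apply/seteqP; split=> [w Aw|w [y Ay /= ->]] //; exists (X t w).
by apply: fin_bigcup_measurable => [|y _]; [exact: finite_finset|exact: mX].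
Qed.

(* By right continuity [X s w] is eventually equal to [X r w], for r the successor
   of s in the grid of mesh 1/(n+1), and the latter is measurable in (s, w). *)
Lemma measurable_occupied (A : {set S}) :
  measurable [set z : R * T | 0 <= z.1 /\ X z.1 z.2 \in A].
Proof.
pose r (n k : nat) : R := k.+1%:R / n.+1%:R.
pose U (n : nat) : set (R * T) :=
  \bigcup_k (`[k%:R / n.+1%:R, r n k[ `*` [set w | X (r n k) w \in A]).
have mU n : measurable (U n).
  apply: bigcupT_measurable => k; apply: measurableX => //.
  by apply: measurable_state_in; rewrite divr_ge0.
have near_r n k s e : 0 < e -> (Num.truncn e^-1 <= n)%N ->
    k%:R / n.+1%:R <= s -> s < r n k -> `|s - r n k| < e.
  move=> e0 en k1 k2; rewrite distrC gtr0_norm ?subr_gt0 //.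
  apply: (@le_lt_trans _ _ n.+1%:R^-1).
    rewrite lerBlDr; apply: le_trans (lerD (lexx _) k1).
    by rewrite /r -nat1r mulrDl mul1r.
  rewrite -[ltRHS]invrK ltf_pV2 ?posrE ?invr_gt0 //.
  have einv_ge0 : 0 <= e^-1 by rewrite invr_ge0 ltW.
  have /andP[_ /lt_le_trans] := truncn_itv einv_ge0.
  by apply; rewrite ler_nat.
(* The set is the lower limit of the [U n]; membership in any [U n] forces a nonnegative time. *)
have -> : [set z : R * T | 0 <= z.1 /\ X z.1 z.2 \in A] =
    \bigcup_N \bigcap_(n in [set n | (N <= n)%N]) U n.
  apply/seteqP; split=> [[s w] /= [s0 Aw]|[s w] [N _ /= hN]].
  - have [e /= e0 he] := rcX w s0.
    exists (Num.truncn e^-1) => // n /= Nn.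
    have n0 : 0 < n.+1%:R :> R by [].
    have /andP[k1 k2] := truncn_itv (mulr_ge0 s0 (ltW n0)).
    exists (Num.truncn (s * n.+1%:R)) => //; split => /=.
      by rewrite in_itv /= /r ler_pdivrMr // k1 ltr_pdivlMr.
    rewrite he //=; last by rewrite /r ltr_pdivlMr.
    by apply: near_r => //; [rewrite ler_pdivrMr|rewrite ltr_pdivlMr].
  - have s0 : 0 <= s.
      have [k _ [/= + _]] := hN N (leqnn N).
      by rewrite in_itv /= => /andP[+ _]; apply: le_trans; rewrite divr_ge0.
    split => //.
    have [e /= e0 he] := rcX w s0.
    have [k _ [/= + Aw]] := hN (maxn N (Num.truncn e^-1)) (leq_maxl _ _).
    rewrite in_itv /= => /andP[k1 k2].
    rewrite he in Aw => //=.
    by apply: near_r => //; exact: leq_maxr.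
apply: bigcupT_measurable => N; apply: bigcap_measurable => //.
by exists N => /=.
Qed.


Local Notation mu := (@lebesgue_measure R).

(** Tonelli for the indicator of the occupied part of [[0, L]] times the sample space. *)
Lemma expected_occupation (A : {set S}) (L : R) : 0 <= L ->
  ('E_P[fun w => (\int[mu]_(s in `[0%R, L]) (X s w \in A)%:R)%R])%E =
  (\int[mu]_(s in `[0%R, L]) P [set w | X s w \in A])%E.
Proof.
move=> L0.
pose U : set (R * T) := (`[0%R, L] `*` setT) `&` [set z | 0 <= z.1 /\ X z.1 z.2 \in A].
have mU : measurable U.
  apply: measurableI; last exact: measurable_occupied.
  exact: measurableX.
have UE s w : \1_U (s, w) = if s \in `[0%R, L]%R then (X s w \in A)%:R else 0 :> R.
  rewrite indicE; case: ifPn => sL; last first.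
    by rewrite memNset // => -[[/= sL' _] _]; rewrite sL' in sL.
  congr (_ %:R); congr nat_of_bool; apply/idP/idP.
    by rewrite inE => -[_ [_ ]].
  move=> Aw; rewrite inE; split; split => //=.
  by move: sL; rewrite in_itv /= => /andP[].
have e1 w : (\int[mu]_(s in `[0%R, L]) ((X s w \in A)%:R)%:E =
    \int[mu]_s (\1_U (s, w))%:E)%E.
  rewrite integral_mkcond; apply: eq_integral => s _.
  by rewrite patchE UE mem_setE; case: ifP.
have e2 w : (\int[mu]_s (\1_U (s, w))%:E)%E = mu (ysection U w).
  rewrite -[ysection U w]setIT -integral_indic //; last exact: measurable_ysection.
  by apply: eq_integral => s _; rewrite !indicE mem_ysection.
(* The inner integral is the real part [fine] of an extended one, and equals it once the section has
   finite measure. *)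
have e3 w : mu (ysection U w) \is a fin_num.
  rewrite ge0_fin_numE //; apply: (@le_lt_trans _ _ (mu `[0%R, L])).
    apply: le_measure; rewrite ?inE //; first exact: measurable_ysection.
    by move=> s; rewrite /ysection /= inE => -[[]].
  by rewrite lebesgue_measure_itv /=; case: ifP => _; rewrite ?ltry // -EFinB ltry.
rewrite unlock /Rintegral.
under eq_integral do rewrite e1 fineK ?e2 // -e2.
rewrite -(@fubini_tonelli _ _ _ _ _ mu P (fun z => (\1_U z)%:E)) /=; first last.
- by move=> z; rewrite lee_fin.
- by apply/measurable_EFinP; exact: measurable_indic.
rewrite [RHS]integral_mkcond; apply: eq_integral => s _.
rewrite patchE mem_setE; case: ifPn => sL; last first.
  by apply: integral0_eq => w _; rewrite UE (negPf sL).
have s0 : 0 <= s by move: sL; rewrite in_itv /= => /andP[].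
rewrite -[X in P X]setIT -integral_indic //; last exact: measurable_state_in.
apply: eq_integral => w _; rewrite UE sL indicE; congr (_ %:R%:E).
by congr nat_of_bool; apply/idP/idP; rewrite inE.
Qed.

End OccupationTime.

(** * One-time laws of the chain and the resolvent bound on its occupation time *)

Section MarkovChainMarginals.
Variables (R : realType) (S : finType) (c : S -> S -> R) (x0 : S).
Variables (d : measure_display) (T : measurableType d).
Variables (P : probability T R) (X : R -> T -> S).
Hypothesis MC : markov_chain c x0 P X.

Local Open Scope classical_set_scope.

Lemma markov_chain_marginal t y : 0 <= t ->
  P [set w | X t w = y] = (transition c t x0 y)%:E.
Proof.
case: MC => mX _ fdd t0.
have mA : measurable [set w | X t w = y] by exact: mX.
have mB : measurable [set w | X 0 w = x0] by exact: mX.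
have PB : P [set w | X 0 w = x0] = 1%E.
  have := fdd 0%N (fun=> 0) (fun=> x0) erefl erefl (fun=> lexx _).
  rewrite big_ord0 => <-; congr (P _); apply/seteqP; split=> w /=.
    by move=> e i.
  by move/(_ 0%N); apply.
have := fdd 1%N (fun i => if i is 0%N then 0 else t)
  (fun i => if i is 0%N then x0 else y) erefl erefl.
rewrite big_ord_recl big_ord0 mulr1 subr0 => <-; last by case=> //=.
have -> : [set w | forall i, (i <= 1)%N ->
     X (if i is 0%N then 0 else t) w = (if i is 0%N then x0 else y)] =
   [set w | X t w = y] `&` [set w | X 0 w = x0].
  apply/seteqP; split=> w /=.
    by move=> h; split; [exact: (h 1%N)|exact: (h 0%N)].
  by case=> h1 h0 [|[|]].
rewrite (measureDI P mA mB) [X in (X + _)%E](_ : _ = 0%E) ?add0e //.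
apply/eqP; rewrite eq_le measure_ge0 andbT.
apply: (@le_trans _ _ (P (~` [set w | X 0 w = x0]))).
  apply: le_measure; rewrite ?inE; last by move=> w [].
    exact: measurableD.
  exact: measurableC.
by rewrite probability_setC // PB subee.
Qed.

(** Nonnegativity of this row of the matrix exponential is read off from the process itself. *)
Lemma transition_ge0 t y : 0 <= t -> 0 <= transition c t x0 y.
Proof. by move=> t0; rewrite -lee_fin -markov_chain_marginal. Qed.

Lemma markov_chain_marginal_in (A : {set S}) t : 0 <= t ->
  P [set w | X t w \in A] = (\sum_(y in A) transition c t x0 y)%:E.
Proof.
move=> t0; case: MC => mX _ _.
have -> : [set w | X t w \in A] = \bigcup_(y in [set` enum A]) [set w | X t w = y].
  apply/seteqP; split=> [w /= Aw|w [y /= Ay ->]]; last by rewrite mem_enum in Ay.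
  by exists (X t w); rewrite /= ?mem_enum.
rewrite measure_fin_bigcup; first last.
- by move=> y _; exact: mX.
- by move=> y z _ _ [w [/= <- <-]].
- exact: finite_seq.
rewrite -fsbig_seq ?enum_uniq // big_enum /= -sumEFin.
by apply: eq_bigr => y _; exact: markov_chain_marginal.
Qed.

Lemma expected_occupation_le_resolvent (A : {set S}) (lam : R) (g : S -> S -> R) :
  0 < lam -> (forall y, resolvent_kernel c lam y (g y)) -> (forall y z, 0 <= g y z) ->
  ('E_P[fun w => (\int[lebesgue_measure]_(s in `[0%R, lam^-1%R]) (X s w \in A)%:R)%R] <=
   (expR 1 / lam * \sum_(y in A) g y x0)%R%:E)%E.
Proof.
move=> lam0 gE g0; case: (MC) => mX rcX _.
rewrite (expected_occupation P mX rcX); last by rewrite invr_ge0 ltW.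
have -> : (\int[lebesgue_measure]_(s in `[0%R, lam^-1%R]) P [set w | X s w \in A] =
    \int[lebesgue_measure]_(s in `[0%R, lam^-1%R])
      \sum_(y <- [seq y <- index_enum S | y \in A]) (transition c s x0 y)%:E)%E.
  apply: eq_integral => s; rewrite inE /= in_itv /= => /andP[s0 _].
  by rewrite markov_chain_marginal_in // -sumEFin big_filter.
have mtr y : measurable_fun `[0, lam^-1] (fun s => (transition c s x0 y)%:E).
  apply/measurable_EFinP; apply: measurable_funTS; apply: continuous_measurable_fun.
  exact: continuous_semigroup.
rewrite ge0_integral_sum //; last first.
  by move=> y s /=; rewrite in_itv /= => /andP[s0 _]; rewrite lee_fin transition_ge0.
rewrite big_filter mulr_sumr -sumEFin; apply: lee_sum => y _.
apply: occupation_le_resolvent => // s z; exact: transition_ge0.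
Qed.

End MarkovChainMarginals.

(** * Low-temperature estimates for the Potts dynamics *)

Lemma cvg_expR_decay (R : realType) (a : R) : 0 < a ->
  (expR (- b * a) @[b --> +oo] --> (0 : R))%classic.
Proof.
move=> a0; apply/cvgrPdist_lt => e e0; near=> b.
have b0 : 0 < b by near: b; apply: nbhs_pinfty_gt; exact: num_real.
rewrite sub0r normrN ger0_norm ?expR_ge0 // mulNr expRN.
rewrite -[ltRHS]invrK ltf_pV2 ?posrE ?expR_gt0 ?invr_gt0 //.
(* [expR (b * a) >= 1 + b * a > e^-1] as soon as [b > e^-1 / a]. *)
apply: lt_le_trans (expR_ge1Dx _).
apply: (@lt_trans _ _ (b * a)); last by rewrite ltrDr.
rewrite -ltr_pdivrMr //; near: b; apply: nbhs_pinfty_gt; exact: num_real.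
Unshelve. all: by end_near. Qed.

Section Potts.
Variables (R : realType) (K L : nat) (h : 'I_3 -> R).
Local Notation H := (hamiltonian h).
Implicit Types s u : config K L.

Lemma adjacentC s u : adjacent s u = adjacent u s.
Proof.
by rewrite /adjacent; congr (_ == _); apply: eq_card => x; rewrite !inE eq_sym.
Qed.

(** Disagreeing sites are set to their value in [u] one at a time. This makes the set whose infimum
    is [Phi s u] nonempty. *)
Lemma adjacent_connected s u : exists2 p, path (@adjacent K L) s p & last s p = u.
Proof.
have [n] := ubnP #|[set x | s x != u x]|; elim: n s => // n IH s su.
have [x xsu|e] := pickP (fun x => s x != u x); last first.
  by exists [::] => //=; apply/ffunP => x; move/negbFE/eqP: (e x).
pose s' : config K L := [ffun z => if z == x then u x else s z].
have [|p s'p pu] := IH s'.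
  rewrite ltnS in su; apply: leq_trans su; apply: proper_card.
  apply/fintype.properP; split.
    apply/fintype.subsetP => z; rewrite !inE ffunE.
    by have [->|//] := eqVneq z x; rewrite eqxx.
  by exists x; rewrite !inE // ffunE !eqxx.
exists (s' :: p) => //=; rewrite s'p andbT /adjacent.
apply/eqP; rewrite -[RHS](cards1 x); apply: eq_card => z; rewrite !inE ffunE.
by have [->|] := eqVneq z x; rewrite ?eqxx.
Qed.

Lemma height_ge s p u : u \in s :: p -> H u <= height h s p.
Proof.
rewrite inE => /orP[/eqP ->|up]; first exact: bigmax_ge_id.
exact: le_bigmax_seq.
Qed.

(** Some [u] of lower energy has [Phi s u < H s + v]; a path whose height exceeds the infimum by
    less than this gap stays below [H s + v]. *)
Lemma stability_level_lt_path s (v : R) : (stability_level h s < v%:E)%E ->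
  exists p, [/\ path (@adjacent K L) s p, H (last s p) < H s
    & forall u, u \in s :: p -> H u < H s + v].
Proof.
rewrite /stability_level /Gam lteBlDr // /PhiSet => /bigmin_ltP[//|[u]].
rewrite inE -EFinD lte_fin => us hPhi.
rewrite /Phi in hPhi; set E := (X in inf X) in hPhi.
have infE : has_inf E.
  split.
    by have [p sp pu] := adjacent_connected s u; exists (height h s p), p.
  by exists (H s) => _ [p [_ _ ->]]; apply: height_ge; rewrite inE eqxx.
have gap : 0 < v + H s - inf E by rewrite subr_gt0.
have [_ [p [sp pu ->]] hp] := inf_adherent gap infE.
exists p; split=> //; first by rewrite pu.
move=> z zp; apply: le_lt_trans (height_ge zp) _; apply: lt_le_trans hp _.
by rewrite addrC subrK addrC.
Qed.

Variable beta : R.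
Hypothesis beta0 : 0 < beta.

Lemma rate_ge0 s u : 0 <= rate h beta s u.
Proof. by rewrite /rate; case: ifP => // _; exact: expR_ge0. Qed.

(** Gibbs weight times Metropolis rate is the weight of the higher endpoint, an expression symmetric
    in [s] and [u]. *)
Lemma rate_weight s u : expR (- beta * H s) * rate h beta s u =
  if adjacent s u then expR (- beta * Num.max (H s) (H u)) else 0.
Proof.
rewrite /rate; case: ifP => _; last by rewrite mulr0.
by rewrite -expRD -mulrDr addr_maxr subrKC addr0 maxC.
Qed.

Lemma detailed_balance s u : expR (- beta * H s) * rate h beta s u =
  expR (- beta * H u) * rate h beta u s.
Proof. by rewrite !rate_weight adjacentC maxC. Qed.

(** The weight ratio bounds [g] at the end of the path. Along it, each edge has conductance at least
    [expR (- beta * m)], so the energy estimate bounds each increment by the square root. *)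
Lemma resolvent_kernel_diag_le (lam m : R) s p g : 0 < lam ->
  resolvent_kernel (rate h beta) lam s g ->
  path (@adjacent K L) s p -> (forall u, u \in s :: p -> H u <= m) ->
  g s <= expR (- beta * (H s - H (last s p))) +
    (size p)%:R * Num.sqrt (2 * lam * expR (beta * (m - H s))).
Proof.
move=> lam0 gE sp hm.
pose r := Num.sqrt (2 * lam * expR (beta * (m - H s))).
(* Adjacency restricted to energies at most [m], so that the increment bound holds for every related
   pair, as [path_variation] asks. *)
pose e := [rel a b : config K L | [&& adjacent a b, H a <= m & H b <= m]].
have w0 u : 0 < expR (- beta * H u) by exact: expR_gt0.
have edge a b : e a b -> `|g a - g b| <= r.
  case/and3P => ab am bm; rewrite -sqrtr_sqr ler_wsqrtr //.
  have := resolvent_kernel_edge rate_ge0 w0 detailed_balance lam0 gE a b.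
  rewrite rate_weight ab mulrC -ler_pdivlMr ?expR_gt0 // => /le_trans; apply.
  rewrite -expRN -!mulrA ler_pM2l // ler_pM2l // -expRD ler_expR.
  have : Num.max (H a) (H b) <= m by rewrite ge_max am.
  by rewrite -(ler_pM2l beta0); lra.
have ep : path e s p.
  elim: p s {gE r edge} sp hm => //= u p IH s /andP[su up] hm.
  rewrite su !hm ?inE ?eqxx ?orbT //= IH // => z zp.
  by rewrite hm // inE zp orbT.
have := path_variation edge ep; have := ler_norm (g s - g (last s p)).
have := resolvent_kernel_le_ratio rate_ge0 w0 detailed_balance lam0 gE (last s p).
rewrite -expRN -expRD -[X in expR X](_ : - beta * (H s - H (last s p)) = _); last ring.
rewrite -/r; lra.
Qed.

End Potts.

(** The kernel varies with [b], so [B] is fixed first and bounds every kernel. Its two terms decay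
    because the path ends below [H s] and its height is strictly below [H s + v]. *)
Lemma resolvent_kernel_diag_cvg0 (R : realType) (K L : nat) (h : 'I_3 -> R) (v t : R)
    (s : config K L) : 0 < t -> (stability_level h s < v%:E)%E ->
  exists B : R -> R, (B b @[b --> +oo] --> (0 : R))%classic /\
    forall b g, 0 < b ->
      resolvent_kernel (rate h b) (t * expR (b * v))^-1 s g -> g s <= B b.
Proof.
move=> t0 /stability_level_lt_path[p [sp Hp hp]].
pose H := @hamiltonian R K L h.
pose m := height h s p.
have mlt : m < H s + v.
  rewrite /m /height big_seq; apply: bigmax_lt; first by apply: hp; rewrite inE eqxx.
  by move=> u up; apply: hp; rewrite inE up orbT.
exists (fun b => expR (- b * (H s - H (last s p))) +
  (size p)%:R * Num.sqrt (2 / t * expR (- b * (H s + v - m)))); split.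
  rewrite -[X in (_ --> X)%classic](addr0 0); apply: cvgD.
    by apply: cvg_expR_decay; rewrite subr_gt0.
  rewrite -[X in (_ --> X)%classic](mulr0 (size p)%:R); apply: cvgMr.
  rewrite -[X in (_ --> X)%classic]sqrtr0 -(mulr0 (2 / t)).
  apply: (@continuous_cvg _ _ _ _ _ _ Num.sqrt); first exact: sqrt_continuous.
  by apply: cvgMr; apply: cvg_expR_decay; rewrite subr_gt0.
move=> b g b0 gE.
have lam0 : 0 < (t * expR (b * v))^-1 by rewrite invr_gt0 mulr_gt0 ?expR_gt0.
have := resolvent_kernel_diag_le b0 lam0 gE sp (m := m).
have hm u : u \in s :: p -> H u <= m by exact: height_ge.
move=> /(_ hm) /le_trans; apply; rewrite lerD2l.
have -> : 2 / (t * expR (b * v)) * expR (b * (m - H s)) =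
    2 / t * expR (- b * (H s + v - m)); last exact: lexx.
rewrite invfM -expRN -!mulrA -expRD; congr (_ * (_ * expR _)); ring.
Qed.

Theorem proposition4p10 (R : realType) (K L : nat) (h1 h2 h3 : R)
  (hK : (0 < K)%N) (hL : (0 < L)%N)
  (h1_gt0 : 0 < h1) (h12 : h1 < h2) (h23 : h2 < h3) (h3_lt1 : h3 < 1)
  (condA : [/\ 3 / (h3 - h2) < K%:R, 3 / (h2 - h1) < K%:R,
               3 / (h3 - h2) < L%:R & 3 / (h2 - h1) < L%:R])
  (condB : forall a b : int, (a, b) != (0, 0) ->
     a%:~R * (h2 - h1) + b%:~R * (h3 - h2) \isn't a Num.int)
  (M : {set config K L}) :
  let h := tnth [tuple h1; h2; h3] in
  let V := min_stability_level h M in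
  let theta := fun beta : R => expR (beta * fine V) in
  let Delta := (~: M)%SET in
  M != finset.set0 ->
  (forall eta s : config K L, eta \in M -> s \notin M ->
     (stability_level h s < stability_level h eta)%E) ->
  V \is a fin_num ->
  forall (xi : config K L) (t : R), 0 < t ->
  forall (d : R -> measure_display) (T : forall beta : R, measurableType (d beta))
    (P : forall beta : R, probability (T beta) R)
    (X : forall beta : R, R -> T beta -> config K L),
  (forall beta : R, 0 < beta ->
     markov_chain (rate h beta) xi (P beta) (X beta)) ->
  ((((theta beta)^-1%R)%:E *
     'E_(P beta)[fun w =>
        (\int[lebesgue_measure]_(s in `[0, t * theta beta]%classic)
           (X beta s w \in Delta)%:R)%R])%E @[beta --> +oo] --> 0%E)%classic.
Proof.
move=> h V theta Delta M0 MV Vfin xi t t0 d T P X MC.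
have stable s : s \in Delta -> (stability_level h s < (fine V)%:E)%E.
  rewrite inE => sM; rewrite fineK //.
  (* The minimum has default value [+oo], so the level of [s] must also lie strictly below [+oo]; an
     element of [M] ensures this. *)
  have /set0Pn[eta etaM] := M0.
  apply: lt_bigmin; first exact: lt_le_trans (MV _ _ etaM sM) (leey _).
  by move=> u uM; exact: MV.
have /choice[B BE] : forall s, exists B : R -> R, s \in Delta ->
    (B b @[b --> +oo] --> (0 : R))%classic /\
    forall b g, 0 < b ->
      resolvent_kernel (rate h b) (t * theta b)^-1 s g -> g s <= B b.
  (* For states of [M] the zero function is a dummy choice. *)
  move=> s; have [sD|sD] := boolP (s \in Delta); last by exists (fun=> 0).
  by have [Bs hB] := resolvent_kernel_diag_cvg0 t0 (stable s sD); exists Bs.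
have theta0 b : 0 < theta b by exact: expR_gt0.
apply: (@squeeze_cvge _ _ _ _ (fun=> 0%E) _
  (fun b => (expR 1 * t * \sum_(s in Delta) B s b)%:E)).
- near=> b.
  have b0 : 0 < b by near: b; apply: nbhs_pinfty_gt; exact: num_real.
  (* With this [lam], the window [[0, lam^-1]] is [[0, t * theta b]], and dividing [expR 1 / lam] by
     [theta b] leaves [expR 1 * t]. *)
  have lam0 : 0 < (t * theta b)^-1 by rewrite invr_gt0 mulr_gt0.
  have [g gE] := choice (fun y : config K L =>
    resolvent_kernel_exists (rate_ge0 h b) y lam0).
  have g0 y := resolvent_kernel_ge0 (rate_ge0 h b) lam0 (gE y).
  apply/andP; split.
    apply: mule_ge0; first by rewrite lee_fin invr_ge0 ltW.
    rewrite unlock; apply: integral_ge0 => w _.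
    by rewrite lee_fin Rintegral_ge0.
  have := expected_occupation_le_resolvent (MC b b0) Delta lam0 gE g0.
  rewrite invrK => /(lee_wpmul2l _) => /(_ (theta b)^-1%:E).
  rewrite lee_fin invr_ge0 => /(_ (ltW (theta0 b))) /le_trans; apply.
  rewrite -EFinM lee_fin.
  have -> x : (theta b)^-1 * (expR 1 * (t * theta b) * x) = expR 1 * t * x.
    by field; rewrite gt_eqF.
  rewrite ler_pM2l ?mulr_gt0 ?expR_gt0 //; apply: ler_sum => y yD.
  (* The maximum principle replaces the starting state [xi] by [y], where the bound [B y]
     applies. *)
  apply: le_trans (resolvent_kernel_le (rate_ge0 h b) lam0 (gE y) xi) _.
  by have [_] := BE y yD; apply.
- exact: cvg_cst.
- apply: cvg_EFin; first exact: nearW.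
  rewrite -[X in (_ --> X)%classic](mulr0 (expR 1 * t)); apply: cvgMr.
  have : (\sum_(s in Delta) B s b @[b --> +oo] --> \sum_(s in Delta) (0 : R))%classic.
    apply: cvg_big => [|s sD]; first exact: add_continuous.
    by have [] := BE s sD.
  by rewrite big1_eq.
Unshelve. all: by end_near. Qed.
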